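(* Let $\ell>0$, $g>0$, $T>0$, and let $f\colon\mathbb R\to\mathbb R^2$ be a $T$-periodic function of class $C^3$. Then the planar Whitney inverted pendulum problem has a $T$-periodic solution, i.e. there exists a $T$-periodic $C^2$ function $x\colon\mathbb R\to\{z\in\mathbb R^2: |z|<\ell\}$ satisfying \[ \ddot x=\frac{1}{\ell^2}\left(g\sqrt{\ell^2-|x|^2}-\frac{(x^T\dot x)^2}{\ell^2-|x|^2}-|\dot x|^2\right)x+\frac{x^T\ddot f(t)}{\ell^2}\,x-\ddot f(t)\quad\text{for all }t\in\mathbb R. \]
   Context: The planar Whitney inverted pendulum problem: a rod of length $\ell$, with its whole mass concentrated at its top, is attached by a frictionless pivot to the floor of a car moving in the horizontal plane, the pivot being at position $f(t)\in\mathbb R^2$ at time $t$; the rod can fall in any direction and moves under gravity (gravitational constant $g$) and the motion of the car. Writing $x(t)\in\mathbb R^2$ for the horizontal position of the top of the rod relative to the pivot (so its height is $\sqrt{\ell^2-|x(t)|^2}$), Newton's law gives the displayed differential equation. Here $|\cdot|$ is the Euclidean norm and $x^Ty$ the scalar product. A solution for which the rod never touches the floor is one with $|x(t)|<\ell$ for all $t$; a $T$-periodic solution of the problem is such a solution which is $T$-periodic. *)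

(* Defs.v *)
From Stdlib Require Import Reals.
From Coquelicot Require Import Coquelicot.
Open Scope R_scope.

Definition Cn (n : nat) (f : R -> R) : Prop :=
  (forall (k : nat) (t : R), (k < n)%nat -> ex_derive (Derive_n f k) t) /\
  (forall t : R, continuous (Derive_n f n) t).

Definition periodic (T : R) (f : R -> R) : Prop :=
  forall t : R, f (t + T) = f t.

Definition whitney_eq (l g : R) (f1 f2 x1 x2 : R -> R) (t : R) : Prop :=
  let X1 := x1 t in let X2 := x2 t in
  let V1 := Derive x1 t in let V2 := Derive x2 t in
  let A1 := Derive_n x1 2 t in let A2 := Derive_n x2 2 t in
  let F1 := Derive_n f1 2 t in let F2 := Derive_n f2 2 t in
  let N := X1 ^ 2 + X2 ^ 2 in
  let c := / l ^ 2 * (g * sqrt (l ^ 2 - N)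
                      - (X1 * V1 + X2 * V2) ^ 2 / (l ^ 2 - N)
                      - (V1 ^ 2 + V2 ^ 2))
           + (X1 * F1 + X2 * F2) / l ^ 2 in
  A1 = c * X1 - F1 /\ A2 = c * X2 - F2.

(* Main.v *)
Require Import Defs.
From Stdlib Require Import Reals Lra Lia ZArith Classical IndefiniteDescription.
From mathcomp Require filter.
From Coquelicot Require Import Coquelicot.
Open Scope R_scope.

(** Lifted to the sphere of radius [l], the equation says that
    [P'' = lam P - G] with [G = (f1'', f2'', g)] and [|P| = l].  These are the extremals
    of the action [int |P'|^2 / 2 - G . P], and a periodic solution is found by minimizing
    it among loops in the closed upper hemisphere.  Time is discretized with step
    [h = T / N], so that a minimizer exists by compactness; because gravity pulls
    down, optimality at one site [k] makes [P_k] parallel to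
    [P_{k+1} + P_{k-1} + h^2 G_k] without any contribution of the constraint
    [P_k . Up >= 0].  Comparing with the constant loop at the north pole bounds the kinetic
    energy, the equation then bounds the total variation of the velocity over a
    period, and the velocity has mean zero, so it is bounded uniformly in [h].  Hence
    positions, velocities and accelerations are uniformly Lipschitz, and the limit
    [h -> 0] solves the equation.  Finally, a loop in the closed hemisphere cannot touch
    the equator: there the height would have a minimum with second derivative [-g]. *)

(** * Limits along an ultrafilter *)

(* Limits along an ultrafilter replace every extraction of subsequences. *)
Class compact_filter (F : (nat -> Prop) -> Prop) : Prop := {
  compact_filter_proper : ProperFilter F;
  compact_filter_eventually : filter_le F eventually;
  compact_filter_lim : forall (u : nat -> R) (M : R),
    (forall n, Rabs (u n) <= M) -> exists x, filterlim u F (locally x) }.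

#[local] Existing Instance compact_filter_proper.

(** Any ultrafilter refining [eventually] works. The limit of a bounded [u] is the supremum [s] of
    the [x] for which [x <= u n] holds along [F]. The ultrafilter dichotomy puts either
    [s + e <= u n] or its complement in [F], and the former would contradict the choice of [s]. *)
Lemma compact_filter_exists : exists F, compact_filter F.
Proof.
destruct (filter.ultraFilterLemma (T := nat) (F := eventually)) as [F [UF FE]].
{ constructor.
  - intros [N HN]. exact (HN N (le_n N)).
  - constructor.
    + exists 0%nat. now intros.
    + intros P Q. apply (@filter_and _ eventually _).
    + intros P Q. apply (@filter_imp _ eventually _). }
pose proof (@filter.filter_filter _ _ (filter.ultra_proper (UltraFilter := UF))) as FF.
assert (PF : ProperFilter F).
{ constructor.
  - intros P HP. apply NNPP; intros HN.
    apply (@filter.filter_not_empty _ _ (filter.ultra_proper (UltraFilter := UF))).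
    refine (@filter.filterS _ _ FF _ _ _ HP).
    intros x Hx. apply HN. now exists x.
  - constructor.
    + exact (@filter.filterT _ _ FF).
    + intros P Q HP HQ. exact (@filter.filterI _ _ FF P Q HP HQ).
    + intros P Q HPQ HP. exact (@filter.filterS _ _ FF P Q HPQ HP). }
exists F; split; [exact PF | exact FE |].
intros u M HM.
assert (bounds : forall n, - M <= u n <= M) by (intros n; now apply Rabs_le_between).
destruct (completeness (fun x => F (fun n => x <= u n))) as [s [ub lub]].
{ exists M. intros x Hx. destruct (filter_ex _ Hx) as [n Hn].
  specialize (bounds n); lra. }
{ exists (- M). apply filter_forall. apply bounds. }
exists s. apply filterlim_locally. intros [e He]; simpl.
assert (above : F (fun n => s - e < u n)).
{ apply NNPP; intros HN.
  enough (s <= s - e / 2) by lra.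
  apply lub. intros x Hx. apply Rnot_lt_le; intros lt.
  apply HN. revert Hx. apply filter_imp. intros n Hn; lra. }
assert (below : F (fun n => u n < s + e)).
{ destruct (filter.in_ultra_setVsetC (T := nat) (fun n => s + e <= u n) UF) as [H|H].
  - specialize (ub _ H). lra.
  - revert H. apply filter_imp. intros n Hn. now apply Rnot_le_lt. }
generalize (filter_and _ _ above below). apply filter_imp. intros n [H1 H2].
apply Rabs_lt_between. unfold minus, plus, opp; simpl. lra.
Qed.

Section Limits.
Context (F : (nat -> Prop) -> Prop) {HF : compact_filter F}.

Lemma lim_const (c : R) : filterlim (fun _ : nat => c) F (locally c).
Proof. apply filterlim_const. Qed.

Lemma lim_plus u v x y : filterlim u F (locally x) -> filterlim v F (locally y) ->
  filterlim (fun n : nat => u n + v n) F (locally (x + y)).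
Proof.
intros Hu Hv.
exact (filterlim_comp_2 _ _ Rplus Hu Hv (filterlim_plus (V := R_NormedModule) x y)).
Qed.

Lemma lim_mult u v x y : filterlim u F (locally x) -> filterlim v F (locally y) ->
  filterlim (fun n : nat => u n * v n) F (locally (x * y)).
Proof.
intros Hu Hv.
exact (filterlim_comp_2 _ _ Rmult Hu Hv (filterlim_mult (K := R_AbsRing) x y)).
Qed.

Lemma lim_scal c u x : filterlim u F (locally x) ->
  filterlim (fun n : nat => c * u n) F (locally (c * x)).
Proof. intros Hu. apply lim_mult; [apply lim_const | exact Hu]. Qed.

Lemma lim_minus u v x y : filterlim u F (locally x) -> filterlim v F (locally y) ->
  filterlim (fun n : nat => u n - v n) F (locally (x - y)).
Proof.
intros Hu Hv. replace (x - y) with (x + - 1 * y) by ring.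
apply filterlim_ext with (fun n => u n + - 1 * v n); [intros n; ring|].
apply lim_plus; [exact Hu | now apply lim_scal].
Qed.

Lemma lim_ext u v (x : R) : (forall n, u n = v n) -> filterlim u F (locally x) ->
  filterlim (v : nat -> R) F (locally x).
Proof. apply filterlim_ext. Qed.

Lemma lim_unique (u : nat -> R) x y :
  filterlim u F (locally x) -> filterlim u F (locally y) -> x = y.
Proof. apply (filterlim_locally_unique (V := R_NormedModule)). Qed.

Lemma lim_le u v x y : (forall n : nat, u n <= v n) ->
  filterlim u F (locally x) -> filterlim v F (locally y) -> x <= y.
Proof.
intros H Hu Hv.
refine (filterlim_le (F := F) u v (Finite x) (Finite y) _ Hu Hv).
now apply filter_forall.
Qed.

Lemma lim_close u v e x : (forall n : nat, Rabs (u n - v n) <= e n) ->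
  filterlim e F (locally 0) -> filterlim v F (locally x) -> filterlim u F (locally x).
Proof.
intros H He Hv. apply filterlim_locally. intros eps.
generalize (filter_and _ _
  (proj1 (filterlim_locally _ _) He (pos_div_2 eps))
  (proj1 (filterlim_locally _ _) Hv (pos_div_2 eps))).
apply filter_imp. intros n. unfold ball; simpl; unfold AbsRing_ball; simpl.
unfold abs, minus, plus, opp; simpl. specialize (H n). revert H. split_Rabs; lra.
Qed.

Lemma lim_abs_le u v x y : (forall n : nat, Rabs (u n) <= v n) ->
  filterlim u F (locally x) -> filterlim v F (locally y) -> Rabs x <= y.
Proof.
intros H Hu Hv. apply Rabs_le. split.
- replace (- y) with (-1 * y) by ring.
  apply lim_le with (fun n => -1 * v n) u; [|now apply lim_scal|exact Hu].
  intros n; specialize (H n); apply Rabs_le_between in H; lra.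
- apply lim_le with u v; [|exact Hu|exact Hv].
  intros n; specialize (H n); apply Rabs_le_between in H; lra.
Qed.

End Limits.

Lemma lim_inv_INR_shift (k : nat) :
  filterlim (fun n => / INR (k + n)) eventually (locally 0).
Proof.
apply (is_lim_seq_spec (fun n => / INR (k + n)) (Finite 0)). intros eps.
destruct (archimed_cor1 eps (cond_pos eps)) as [m [Hm m0]].
exists m. intros n Hn. rewrite Rminus_0_r, Rabs_pos_eq.
- apply Rle_lt_trans with (/ INR m); [|exact Hm].
  apply Rinv_le_contravar; [now apply lt_0_INR | apply le_INR; lia].
- apply Rlt_le, Rinv_0_lt_compat, lt_0_INR. lia.
Qed.

(** * Maximizing the discrete gain *)

Inductive axis := East | North | Up.

Definition dot (a b : axis -> R) : R :=
  a East * b East + a North * b North + a Up * b Up.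

Lemma dot_ge0 a : 0 <= dot a a.
Proof. unfold dot. nra. Qed.

Lemma sphere_coord_le r a i : 0 <= r -> dot a a = r ^ 2 -> Rabs (a i) <= r.
Proof.
intros Hr H. apply Rabs_le. unfold dot in H.
destruct i; nra.
Qed.

Lemma dot_abs_le (a b : axis -> R) A B :
  (forall i, Rabs (a i) <= A) -> (forall i, Rabs (b i) <= B) ->
  Rabs (dot a b) <= 3 * (A * B).
Proof.
intros Ha Hb.
assert (H : forall i, Rabs (a i * b i) <= A * B).
{ intros i. rewrite Rabs_mult. apply Rmult_le_compat; auto using Rabs_pos. }
unfold dot.
generalize (H East) (H North) (H Up). split_Rabs; lra.
Qed.

Lemma eq_of_dot_sub_le0 a b : dot (fun i => a i - b i) (fun i => a i - b i) <= 0 ->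
  forall i, a i = b i.
Proof.
unfold dot; intros H i.
pose proof (pow2_ge_0 (a East - b East)).
pose proof (pow2_ge_0 (a North - b North)).
pose proof (pow2_ge_0 (a Up - b Up)).
destruct i; nra.
Qed.

(** * Sums over windows of consecutive integers *)

Fixpoint zsum (u : Z -> R) (s : Z) (n : nat) : R :=
  match n with
  | O => 0
  | S m => zsum u s m + u (s + Z.of_nat m)%Z
  end.

Lemma zsum_ext u v s n :
  (forall k, (s <= k < s + Z.of_nat n)%Z -> u k = v k) -> zsum u s n = zsum v s n.
Proof.
induction n as [|n IH]; intros H; simpl; [reflexivity|].
rewrite IH, H; [reflexivity | lia | intros k Hk; apply H; lia].
Qed.

Lemma zsum_plus u v s n : zsum (fun k => u k + v k) s n = zsum u s n + zsum v s n.
Proof. induction n as [|n IH]; simpl; [|rewrite IH]; ring. Qed.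

Lemma zsum_scal c u s n : zsum (fun k => c * u k) s n = c * zsum u s n.
Proof. induction n as [|n IH]; simpl; [|rewrite IH]; ring. Qed.

Lemma zsum_const c s n : zsum (fun _ => c) s n = INR n * c.
Proof. induction n as [|n IH]; [simpl; ring|]. rewrite S_INR; simpl; rewrite IH; ring. Qed.

Lemma zsum_le u v s n : (forall k, u k <= v k) -> zsum u s n <= zsum v s n.
Proof. intros H. induction n as [|n IH]; simpl; [lra|]. now apply Rplus_le_compat. Qed.

Lemma zsum_abs u s n : Rabs (zsum u s n) <= zsum (fun k => Rabs (u k)) s n.
Proof.
induction n as [|n IH]; simpl; [rewrite Rabs_R0; lra|].
eapply Rle_trans; [apply Rabs_triang|]. lra.
Qed.

Lemma zsum_incr u s n m : (forall k, 0 <= u k) -> (n <= m)%nat -> zsum u s n <= zsum u s m.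
Proof.
intros H. induction 1 as [|m _ IH]; simpl; [lra|].
specialize (H (s + Z.of_nat m)%Z). lra.
Qed.

Lemma zsum_split_first u s n : zsum u s (S n) = u s + zsum u (s + 1) n.
Proof.
induction n as [|n IH]; [simpl; rewrite Z.add_0_r; ring|].
change (zsum u s (S n) + u (s + Z.of_nat (S n))%Z
  = u s + (zsum u (s + 1) n + u (s + 1 + Z.of_nat n)%Z)).
rewrite IH. replace (s + 1 + Z.of_nat n)%Z with (s + Z.of_nat (S n))%Z by lia. ring.
Qed.

Lemma zsum_telescope u s n :
  zsum (fun k => u (k + 1)%Z - u k) s n = u (s + Z.of_nat n)%Z - u s.
Proof.
induction n as [|n IH]; simpl zsum; [rewrite Z.add_0_r; ring|].
rewrite IH. replace (s + Z.of_nat n + 1)%Z with (s + Z.of_nat (S n))%Z by lia. ring.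
Qed.

Lemma zsum_shift u c s n : zsum (fun k => u (k + c)%Z) s n = zsum u (s + c) n.
Proof.
induction n as [|n IH]; simpl zsum; [reflexivity|].
rewrite IH. do 2 f_equal. ring.
Qed.

(** Moving the window by one site drops [u r] and gains [u (r + N)], which is the same number;
    induction in both directions reaches every start. *)
Lemma zsum_periodic u N s : (forall k, u (k + Z.of_nat N)%Z = u k) ->
  zsum u s N = zsum u 0 N.
Proof.
intros H.
assert (step : forall r, zsum u (r + 1) N = zsum u r N).
{ intros r. apply (Rplus_eq_reg_l (u r)). rewrite <- zsum_split_first. simpl.
  rewrite H. ring. }
destruct (Z.le_gt_cases 0 s) as [Hs|Hs].
- revert s Hs. apply natlike_ind; [reflexivity|].
  intros r _ IH. unfold Z.succ. now rewrite step.
- assert (Hm : forall m : Z, (0 <= m)%Z -> zsum u (- m) N = zsum u 0 N).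
  { apply natlike_ind; [reflexivity|]. intros r _ IH.
    rewrite <- IH, <- (step (- Z.succ r)%Z). f_equal. lia. }
  rewrite <- (Hm (- s)%Z) by lia. f_equal. lia.
Qed.

Lemma filterlim_zsum F {HF : compact_filter F} (u : nat -> Z -> R) (v : Z -> R) s N :
  (forall k, filterlim (fun n => u n k) F (locally (v k))) ->
  filterlim (fun n => zsum (u n) s N) F (locally (zsum v s N)).
Proof.
intros H. induction N as [|N IH]; simpl; [apply (lim_const F)|]. now apply (lim_plus F).
Qed.

(** The height condition is not strict, so that these loops are closed under pointwise limits;
    contact with the equator is excluded only for the solution in continuous time. *)
Record hemi_loop (l : R) (N : nat) (p : Z -> axis -> R) : Prop := {
  hemi_periodic : forall k i, p (k + Z.of_nat N)%Z i = p k i;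
  hemi_sphere : forall k, dot (p k) (p k) = l ^ 2;
  hemi_up : forall k, 0 <= p k Up }.

(* Since [|p k|] is fixed, this is minus the discrete action up to a constant and scaling. *)
Definition gain (N : nat) (b p : Z -> axis -> R) : R :=
  zsum (fun k => dot (p k) (p (k + 1)%Z) + dot (b k) (p k)) 0 N.

Lemma hemi_loop_const l N c : dot c c = l ^ 2 -> 0 <= c Up -> hemi_loop l N (fun _ => c).
Proof. now split. Qed.

Lemma gain_bound l N b : 0 < l ->
  exists M, forall p, hemi_loop l N p -> gain N b p <= M.
Proof.
intros Hl.
exists (zsum (fun k => 3 * (l * l)
  + 3 * ((Rabs (b k East) + Rabs (b k North) + Rabs (b k Up)) * l)) 0 N).
intros p Hp. unfold gain. apply zsum_le. intros k.
assert (Hc : forall k i, Rabs (p k i) <= l).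
{ intros j i. apply sphere_coord_le; [lra | apply (hemi_sphere l N p Hp)]. }
apply Rplus_le_compat; eapply Rle_trans; try apply Rle_abs; apply dot_abs_le; auto.
intros i. pose proof (Rabs_pos (b k East)). pose proof (Rabs_pos (b k North)).
pose proof (Rabs_pos (b k Up)). destruct i; lra.
Qed.

(** The coordinatewise ultrafilter limit of a maximizing sequence is a maximizer: the constraints
    are closed conditions, and the gain is a finite sum of products of coordinates. *)
Lemma gain_maximizer l N b : 0 < l ->
  exists p, hemi_loop l N p /\ forall q, hemi_loop l N q -> gain N b q <= gain N b p.
Proof.
intros Hl. destruct compact_filter_exists as [F HF].
destruct (gain_bound l N b Hl) as [M HM].
destruct (completeness (fun r => exists p, hemi_loop l N p /\ r = gain N b p))
  as [s [ub lub]].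
{ exists M. intros r [p [Hp ->]]. auto. }
(* The constant loop at the north pole shows that there are gains at all. *)
{ eexists. exists (fun _ i => match i with Up => l | _ => 0 end). split; [|reflexivity].
  apply hemi_loop_const; [unfold dot; ring | lra]. }
assert (Hseq : forall n, exists p, hemi_loop l N p /\ s - / INR (S n) <= gain N b p).
{ intros n. apply NNPP; intros Hn.
  assert (pos : 0 < / INR (S n)) by (apply Rinv_0_lt_compat, lt_0_INR; lia).
  enough (s <= s - / INR (S n)) by lra.
  apply lub. intros r [p [Hp ->]]. apply Rnot_lt_le; intros lt.
  apply Hn. exists p. split; [exact Hp | lra]. }
apply functional_choice in Hseq. destruct Hseq as [P HP].
assert (Hlim : forall ki : Z * axis, exists x,
  filterlim (fun n => P n (fst ki) (snd ki)) F (locally x)).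
{ intros [k i]. apply (compact_filter_lim _ l). intros n.
  apply sphere_coord_le; [lra|]. apply (hemi_sphere l N), HP. }
apply functional_choice in Hlim. destruct Hlim as [p0 Hp0].
set (p k i := p0 (k, i)).
assert (Hp : forall k i, filterlim (fun n => P n k i) F (locally (p k i))).
{ intros k i. apply (Hp0 (k, i)). }
assert (Hdot : forall k j, filterlim (fun n => dot (P n k) (P n j)) F
  (locally (dot (p k) (p j)))).
{ intros k j. unfold dot. repeat apply (lim_plus F); apply (lim_mult F); apply Hp. }
exists p. split.
- split.
  + intros k i. apply (lim_unique F (fun n => P n k i)); [|apply Hp].
    apply (lim_ext F) with (fun n => P n (k + Z.of_nat N)%Z i); [|apply Hp].
    intros n. apply (hemi_periodic l N), HP.
  + intros k. apply (lim_unique F (fun n => dot (P n k) (P n k))); [apply Hdot|].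
    apply (lim_ext F) with (fun _ => l ^ 2); [|apply (lim_const F)].
    intros n. symmetry. apply (hemi_sphere l N), HP.
  + intros k. apply (lim_le F (fun _ => 0) (fun n => P n k Up));
      [|apply (lim_const F)|apply Hp].
    intros n. apply (hemi_up l N), HP.
- enough (Hs : s <= gain N b p).
  { intros q Hq. apply Rle_trans with s; [apply ub; eauto | exact Hs]. }
  apply (lim_le F (fun n => s - / INR (S n)) (fun n => gain N b (P n))).
  + apply HP.
  + replace s with (s - 0) at 1 by ring. apply (lim_minus F); [apply (lim_const F)|].
    apply filterlim_filter_le_1 with (1 := compact_filter_eventually).
    apply (lim_inv_INR_shift 1).
  + unfold gain. apply filterlim_zsum; [exact HF|]. intros k.
    apply (lim_plus F); [apply Hdot|].
    unfold dot. repeat apply (lim_plus F); apply (lim_scal F); apply Hp.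
Qed.

(** The whole residue class of [j] modulo [N] is changed, so that the new loop stays periodic. *)
Definition set_site (N : nat) (p : Z -> axis -> R) (j : Z) (c : axis -> R) (k : Z) :
    axis -> R :=
  if Z.eq_dec ((k - j) mod Z.of_nat N) 0 then c else p k.

Lemma set_site_eq N p j c : set_site N p j c j = c.
Proof.
unfold set_site. rewrite Z.sub_diag, Zmod_0_l. now destruct Z.eq_dec.
Qed.

Lemma set_site_neq N p j c k : (0 < k - j < Z.of_nat N)%Z -> set_site N p j c k = p k.
Proof.
intros H. unfold set_site. rewrite Z.mod_small by lia.
destruct Z.eq_dec; [lia | reflexivity].
Qed.

Lemma set_site_periodic N p j c k i : (0 < N)%nat ->
  (forall k i, p (k + Z.of_nat N)%Z i = p k i) ->
  set_site N p j c (k + Z.of_nat N)%Z i = set_site N p j c k i.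
Proof.
intros HN H. unfold set_site.
replace (k + Z.of_nat N - j)%Z with (k - j + 1 * Z.of_nat N)%Z by ring.
rewrite Z_mod_plus_full. destruct Z.eq_dec; auto.
Qed.

Lemma dot_ext a b c d : (forall i, a i = c i) -> (forall i, b i = d i) -> dot a b = dot c d.
Proof. intros H K. unfold dot. now rewrite !H, !K. Qed.

(** The gain is affine in the value at one site, which enters only through the products with its two
    neighbours and its own forcing term. With [2 <= N] the neighbours lie outside the residue class
    of [j]. *)
Lemma gain_set_site l N b p j c : (2 <= N)%nat -> hemi_loop l N p ->
  (forall k i, b (k + Z.of_nat N)%Z i = b k i) ->
  gain N b (set_site N p j c) - gain N b p =
  dot (fun i => c i - p j i) (fun i => p (j + 1)%Z i + p (j - 1)%Z i + b j i).
Proof.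
intros HN Hp Hb. destruct N as [|[|m]]; try lia.
pose proof (hemi_periodic _ _ _ Hp) as Hper.
assert (Hsper := fun k i => set_site_periodic _ p j c k i (Nat.lt_0_succ (S m)) Hper).
(* Starting the period at [j - 1] isolates the two terms that involve site [j]; the remaining [m]
   terms are the same for both loops. *)
assert (shift : forall q : Z -> axis -> R,
  (forall k i, q (k + Z.of_nat (S (S m)))%Z i = q k i) ->
  gain (S (S m)) b q =
  dot (q (j - 1)%Z) (q j) + dot (b (j - 1)%Z) (q (j - 1)%Z)
  + (dot (q j) (q (j + 1)%Z) + dot (b j) (q j)
  + zsum (fun k => dot (q k) (q (k + 1)%Z) + dot (b k) (q k)) (j + 1) m)).
{ intros q Hq. unfold gain. rewrite <- (zsum_periodic _ _ (j - 1)).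
  - rewrite zsum_split_first. replace (j - 1 + 1)%Z with j by ring.
    now rewrite zsum_split_first.
  - intros k. f_equal; apply dot_ext; intros i; auto.
    replace (k + Z.of_nat (S (S m)) + 1)%Z with (k + 1 + Z.of_nat (S (S m)))%Z by ring.
    apply Hq. }
rewrite (shift _ Hsper), (shift _ Hper).
rewrite (zsum_ext _ (fun k => dot (p k) (p (k + 1)%Z) + dot (b k) (p k))).
2:{ intros k Hk. rewrite (set_site_neq _ _ _ _ k) by lia.
    destruct (Z.eq_dec k (j + Z.of_nat (S m))) as [e|ne]; [lia|].
    rewrite set_site_neq by lia. reflexivity. }
rewrite set_site_eq, (set_site_neq _ _ _ _ (j + 1)) by lia.
(* [set_site_neq] covers offsets strictly between 0 and [N], so the site [j - 1] is first moved one
   period forward. *)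
assert (prev : forall i, set_site (S (S m)) p j c (j - 1)%Z i = p (j - 1)%Z i).
{ intros i. rewrite <- Hsper, <- Hper.
  rewrite set_site_neq by lia. reflexivity. }
unfold dot. rewrite !prev. ring.
Qed.

(* The positive vertical forcing keeps the new site value [l w / |w|] in the hemisphere,
   so optimality of [p] at a single site forces [p j] to be parallel to [w]. *)
Lemma maximizer_stationary l N b p : 0 < l -> (2 <= N)%nat ->
  (forall k i, b (k + Z.of_nat N)%Z i = b k i) -> (forall k, 0 < b k Up) ->
  hemi_loop l N p -> (forall q, hemi_loop l N q -> gain N b q <= gain N b p) ->
  forall j, exists mu, forall i, p (j + 1)%Z i + p (j - 1)%Z i + b j i = mu * p j i.
Proof.
intros Hl HN Hb Hpos Hp Hmax j.
set (w i := p (j + 1)%Z i + p (j - 1)%Z i + b j i).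
assert (wUp : 0 < w Up).
{ unfold w. pose proof (hemi_up _ _ _ Hp (j + 1)). pose proof (hemi_up _ _ _ Hp (j - 1)).
  specialize (Hpos j). lra. }
assert (ww : 0 < dot w w) by (unfold dot; nra).
set (r := sqrt (dot w w)).
assert (r0 : 0 < r) by now apply sqrt_lt_R0.
assert (r2 : dot w w = r * r) by (unfold r; rewrite sqrt_sqrt; lra).
set (c i := l / r * w i).
assert (cc : dot c c = l ^ 2).
{ transitivity ((l / r) ^ 2 * dot w w); [unfold c, dot; ring|]. rewrite r2. field. lra. }
assert (lr : 0 < l / r) by now apply Rdiv_lt_0_compat.
assert (cUp : 0 <= c Up) by (unfold c; apply Rlt_le, Rmult_lt_0_compat; lra).
assert (Hq : hemi_loop l N (set_site N p j c)).
{ split.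
  - intros k i. apply set_site_periodic; [lia|]. apply (hemi_periodic _ _ _ Hp).
  - intros k. unfold set_site. destruct Z.eq_dec; [exact cc|]. apply (hemi_sphere _ _ _ Hp).
  - intros k. unfold set_site. destruct Z.eq_dec; [exact cUp|]. apply (hemi_up _ _ _ Hp). }
specialize (Hmax _ Hq).
pose proof (gain_set_site l N b p j c HN Hp Hb) as Hgain. fold w in Hgain.
assert (opt : dot c w <= dot (p j) w).
{ replace (dot c w) with (dot (fun i => c i - p j i) w + dot (p j) w)
    by (unfold dot; ring). lra. }
assert (cw : dot c w = l * r).
{ transitivity (l / r * dot w w); [unfold c, dot; ring|]. rewrite r2. field. lra. }
(* Equality case of Cauchy-Schwarz: the squared length of [w - (r / l) p j] is
   [2 r^2 - 2 (r / l) dot (p j) w], and optimality gives [dot (p j) w >= l r]. *)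
exists (r / l). apply eq_of_dot_sub_le0.
replace (dot _ _) with (dot w w - 2 * (r / l) * dot (p j) w + (r / l) ^ 2 * dot (p j) (p j))
  by (unfold dot; unfold w; ring).
rewrite (hemi_sphere _ _ _ Hp), r2.
replace ((r / l) ^ 2 * l ^ 2) with (r * r) by (field; lra).
assert (rl : 0 < r / l) by now apply Rdiv_lt_0_compat.
assert (r / l * (l * r) <= r / l * dot (p j) w) by (apply Rmult_le_compat_l; lra).
replace (r / l * (l * r)) with (r * r) in H by (field; lra). lra.
Qed.

(** * Bounds on discrete orbits *)

Definition velocity (h : R) (p : Z -> axis -> R) (k : Z) (i : axis) : R :=
  (p (k + 1)%Z i - p k i) / h.

(* The acceleration at [p], with the kinetic term averaged over two velocities [v], [u]. *)
Definition accel (l : R) (G p v u : axis -> R) (i : axis) : R :=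
  (dot G p - (dot v v + dot u u) / 2) / l ^ 2 * p i - G i.

Section DiscreteOrbit.
Context (l h B : R) (N : nat) (G p : Z -> axis -> R).
Context (l0 : 0 < l) (h0 : 0 < h) (N2 : (2 <= N)%nat).
Context (GB : forall k i, Rabs (G k i) <= B).
Context (Gper : forall k i, G (k + Z.of_nat N)%Z i = G k i).
Context (Hp : hemi_loop l N p).
Let v := velocity h p.
Let b k i := h ^ 2 * G k i.

Lemma velocity_periodic k i : v (k + Z.of_nat N)%Z i = v k i.
Proof.
unfold v, velocity. replace (k + Z.of_nat N + 1)%Z with (k + 1 + Z.of_nat N)%Z by ring.
now rewrite !(hemi_periodic _ _ _ Hp).
Qed.

(** Polarization: [h * v k] is the chord between two points of the sphere of radius [l]. *)
Lemma dot_next k : dot (p k) (p (k + 1)%Z) = l ^ 2 - h ^ 2 * dot (v k) (v k) / 2.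
Proof.
pose proof (hemi_sphere _ _ _ Hp k) as A. pose proof (hemi_sphere _ _ _ Hp (k + 1)) as C.
replace (h ^ 2 * dot (v k) (v k)) with
  (dot (p k) (p k) + dot (p (k + 1)%Z) (p (k + 1)%Z) - 2 * dot (p k) (p (k + 1)%Z)).
- rewrite A, C. field.
- unfold dot, v, velocity. field. lra.
Qed.

(** The multiplier is found by pairing the relation with [p k]. By [dot_next] the products with the
    two neighbours become the squared speeds on the two adjacent edges, which explains the average
    in [accel]. *)
Lemma stationary_accel k mu :
  (forall i, p (k + 1)%Z i + p (k - 1)%Z i + b k i = mu * p k i) ->
  forall i, v k i - v (k - 1)%Z i = h * accel l (G k) (p k) (v k) (v (k - 1)%Z) i.
Proof.
intros H.
assert (Hmu : mu * l ^ 2 = dot (p k) (p (k + 1)%Z) + dot (p (k - 1)%Z) (p k)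
  + h ^ 2 * dot (G k) (p k)).
{ rewrite <- (hemi_sphere _ _ _ Hp k).
  transitivity (dot (fun i => mu * p k i) (p k)); [unfold dot; ring|].
  transitivity (dot (fun i => p (k + 1)%Z i + p (k - 1)%Z i + b k i) (p k)).
  - apply dot_ext; [intros i; symmetry; apply H | reflexivity].
  - unfold dot, b. ring. }
pose proof (dot_next (k - 1)) as D. replace (k - 1 + 1)%Z with k in D by ring.
rewrite dot_next, D in Hmu.
intros i. specialize (H i).
assert (Hl : l ^ 2 <> 0) by (apply pow_nonzero; lra).
assert (Hmu' : (mu - 2) * l ^ 2 = h ^ 2 *
  (dot (G k) (p k) - (dot (v k) (v k) + dot (v (k - 1)%Z) (v (k - 1)%Z)) / 2)) by lra.
unfold accel. set (lam := dot (G k) (p k) - _) in *.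
replace lam with ((mu - 2) * l ^ 2 / h ^ 2) by (rewrite Hmu'; field; lra).
unfold v, velocity. replace (k - 1 + 1)%Z with k by ring.
unfold b in H.
replace (p (k + 1)%Z i) with (mu * p k i - p (k - 1)%Z i - h ^ 2 * G k i) by lra.
field. lra.
Qed.

(** The left side is a lower bound for the gain of a constant loop; a maximizer satisfies the
    inequality by comparison with the north pole. *)
Context (energy : INR N * l ^ 2 - h ^ 2 * (3 * INR N * (B * l)) <= gain N b p).

Lemma force_dot_le k : Rabs (dot (G k) (p k)) <= 3 * (B * l).
Proof.
apply dot_abs_le; [auto|]. intros i. apply sphere_coord_le; [lra|].
apply (hemi_sphere _ _ _ Hp).
Qed.

(** By [dot_next] the gain is [N l^2], minus [h^2 / 2] times the kinetic sum, plus [h^2] times the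
    work of the forcing. In [energy] the terms [N l^2] cancel, and two forcing terms of size at most
    [3 N B l] remain. *)
Lemma kinetic_bound s : zsum (fun k => dot (v k) (v k)) s N <= 12 * INR N * (B * l).
Proof.
rewrite zsum_periodic
  by (intros k; apply dot_ext; intros i; apply velocity_periodic).
unfold gain in energy.
rewrite (zsum_ext _ (fun k => (l ^ 2 + (- (h ^ 2 / 2)) * dot (v k) (v k))
  + h ^ 2 * dot (G k) (p k))) in energy.
2:{ intros k _. rewrite dot_next. unfold b, dot. field. }
rewrite !zsum_plus, zsum_const, !zsum_scal in energy.
assert (Hf : zsum (fun k => dot (G k) (p k)) 0 N <= INR N * (3 * (B * l))).
{ rewrite <- (zsum_const _ 0). apply zsum_le. intros k.
  generalize (force_dot_le k). split_Rabs; lra. }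
apply Rmult_le_reg_l with (h ^ 2 / 2); [apply Rdiv_lt_0_compat; [apply pow_lt|]; lra|].
assert (h2 : 0 < h ^ 2) by now apply pow_lt.
apply (Rmult_le_compat_l (h ^ 2)) in Hf; [|lra]. lra.
Qed.

Context (equation : forall k i,
  v k i - v (k - 1)%Z i = h * accel l (G k) (p k) (v k) (v (k - 1)%Z) i).

Lemma velocity_increment k i : Rabs (v (k + 1)%Z i - v k i) <=
  h * (4 * B) + h / (2 * l) * (dot (v (k + 1)%Z) (v (k + 1)%Z) + dot (v k) (v k)).
Proof.
pose proof (equation (k + 1) i) as E. replace (k + 1 - 1)%Z with k in E by ring.
rewrite E, Rabs_mult, (Rabs_pos_eq h) by lra.
replace (h * (4 * B) + _) with (h * ((3 * (B * l) +
  (dot (v (k + 1)%Z) (v (k + 1)%Z) + dot (v k) (v k)) / 2) / l ^ 2 * l + B))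
  by (field; lra).
apply Rmult_le_compat_l; [lra|]. unfold accel.
assert (l2 : 0 < / l ^ 2) by (apply Rinv_0_lt_compat, pow_lt; lra).
apply Rle_trans with (Rabs ((dot (G (k + 1)%Z) (p (k + 1)%Z) -
  (dot (v (k + 1)%Z) (v (k + 1)%Z) + dot (v k) (v k)) / 2) / l ^ 2 * p (k + 1)%Z i)
  + Rabs (G (k + 1)%Z i)); [split_Rabs; lra|].
apply Rplus_le_compat; [|apply GB].
rewrite Rabs_mult. apply Rmult_le_compat; try apply Rabs_pos.
- unfold Rdiv at 1. rewrite Rabs_mult, (Rabs_pos_eq (/ l ^ 2)) by lra.
  apply Rmult_le_compat_r; [lra|].
  pose proof (force_dot_le (k + 1)). pose proof (dot_ge0 (v k)).
  pose proof (dot_ge0 (v (k + 1)%Z)). split_Rabs; lra.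
- apply sphere_coord_le; [lra | apply (hemi_sphere _ _ _ Hp)].
Qed.

(** Summing [velocity_increment] over one period, the forcing gives [4 N h B] and the two kinetic
    sums give [24 N B l * h / (2 l) = 12 N h B]. Since [N h] is the period, the bound does not
    depend on the step. *)
Lemma velocity_oscillation s m i : (m <= N)%nat ->
  Rabs (v (s + Z.of_nat m)%Z i - v s i) <= 16 * (INR N * h) * B.
Proof.
intros Hm.
rewrite <- (zsum_telescope (fun k => v k i)).
eapply Rle_trans; [apply zsum_abs|].
eapply Rle_trans; [apply zsum_incr with (m := N); [intros; apply Rabs_pos | exact Hm]|].
eapply Rle_trans; [apply zsum_le; intros k; apply velocity_increment|].
rewrite (zsum_plus (fun _ => h * (4 * B))), zsum_const, zsum_scal,
  (zsum_plus (fun k => dot (v (k + 1)%Z) (v (k + 1)%Z))).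
pose proof (kinetic_bound s) as K.
assert (K' : zsum (fun k => dot (v (k + 1)%Z) (v (k + 1)%Z)) s N <= 12 * INR N * (B * l)).
{ rewrite zsum_periodic; [|intros k; apply dot_ext; intros j;
    rewrite <- (velocity_periodic (k + 1)); f_equal; ring].
  rewrite zsum_periodic in K by (intros k; apply dot_ext; intros j; apply velocity_periodic).
  eapply Rle_trans; [|exact K]. apply Req_le.
  rewrite <- (zsum_periodic (fun k => dot (v k) (v k)) N 1)
    by (intros k; apply dot_ext; intros j; apply velocity_periodic).
  exact (zsum_shift (fun k => dot (v k) (v k)) 1 0 N). }
apply Rle_trans with (INR N * (h * (4 * B)) + h / (2 * l) *
  (12 * INR N * (B * l) + 12 * INR N * (B * l))).
- apply Rplus_le_compat_l, Rmult_le_compat_l; [|lra].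
  apply Rlt_le, Rdiv_lt_0_compat; lra.
- apply Req_le. field. lra.
Qed.

(** The velocities over a period sum to zero, so [v k] is minus the average of the differences
    [v j - v k], each controlled by the oscillation. *)
Lemma velocity_bound k i : Rabs (v k i) <= 16 * (INR N * h) * B.
Proof.
assert (Npos : 0 < INR N) by (apply lt_0_INR; lia).
assert (mean0 : zsum (fun j => v j i) k N = 0).
{ rewrite (zsum_ext _ (fun j => / h * (p (j + 1)%Z i - p j i)))
    by (intros; unfold v, velocity, Rdiv; ring).
  rewrite zsum_scal, (zsum_telescope (fun j => p j i)), (hemi_periodic _ _ _ Hp). ring. }
apply Rmult_le_reg_l with (INR N); [exact Npos|].
rewrite <- (Rabs_pos_eq (INR N)) at 1 by lra. rewrite <- Rabs_mult.
replace (INR N * v k i) with (- zsum (fun j => v j i + -1 * v k i) k N)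
  by (rewrite zsum_plus, mean0, zsum_const; ring).
rewrite Rabs_Ropp. eapply Rle_trans; [apply zsum_abs|].
rewrite <- (zsum_const _ k).
(* The oscillation bound holds only within one period, so the termwise comparison is done by
   induction on [m <= N]. *)
assert (H : forall m, (m <= N)%nat ->
  zsum (fun j => Rabs (v j i + -1 * v k i)) k m <=
  zsum (fun _ => 16 * (INR N * h) * B) k m).
{ induction m as [|m IH]; intros Hm; simpl; [lra|].
  apply Rplus_le_compat; [apply IH; lia|].
  replace (v (k + Z.of_nat m)%Z i + -1 * v k i) with (v (k + Z.of_nat m)%Z i - v k i) by ring.
  apply velocity_oscillation. lia. }
now apply H.
Qed.

End DiscreteOrbit.

Lemma discrete_orbit l h B N G : 0 < l -> 0 < h -> (2 <= N)%nat ->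
  (forall k i, Rabs (G k i) <= B) -> (forall k i, G (k + Z.of_nat N)%Z i = G k i) ->
  (forall k, 0 < G k Up) ->
  exists p, hemi_loop l N p /\
    (forall k i, Rabs (velocity h p k i) <= 16 * (INR N * h) * B) /\
    (forall k i, velocity h p k i - velocity h p (k - 1) i =
       h * accel l (G k) (p k) (velocity h p k) (velocity h p (k - 1)) i).
Proof.
intros l0 h0 N2 GB Gper Gup.
assert (h2 : 0 < h ^ 2) by now apply pow_lt.
(* The factor [h ^ 2] matches the forcing to the second difference of [p]. *)
destruct (gain_maximizer l N (fun k i => h ^ 2 * G k i) l0) as [p [Hp Hmax]].
exists p. split; [exact Hp|].
assert (eqn : forall k i, velocity h p k i - velocity h p (k - 1) i =
       h * accel l (G k) (p k) (velocity h p k) (velocity h p (k - 1)) i).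
{ intros k. destruct (maximizer_stationary l N (fun k i => h ^ 2 * G k i) p l0 N2) with (j := k) as [mu Hmu];
    [| |exact Hp|exact Hmax|].
  - intros; now rewrite Gper.
  - intros; now apply Rmult_lt_0_compat.
  - exact (stationary_accel l h N G p l0 h0 Hp k mu Hmu). }
split; [|exact eqn].
apply velocity_bound with (l := l) (G := G); auto.
(* The north pole serves as the competitor that yields the energy inequality. *)
set (c := fun i => match i with Up => l | _ => 0 end).
assert (cc : dot c c = l ^ 2) by (unfold dot, c; ring).
eapply Rle_trans; [|apply Hmax; apply (hemi_loop_const l N c cc); simpl; lra].
unfold gain. rewrite zsum_plus, zsum_const, cc.
rewrite (zsum_ext _ (fun k => h ^ 2 * dot (G k) c)) by (intros; unfold dot; ring).
rewrite zsum_scal.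
assert (H : INR N * (- (3 * (B * l))) <= zsum (fun k => dot (G k) c) 0 N).
{ rewrite <- (zsum_const _ 0). apply zsum_le. intros k.
  assert (Rabs (dot (G k) c) <= 3 * (B * l)).
  { apply dot_abs_le; [auto|]. intros i. apply sphere_coord_le; [lra | exact cc]. }
  split_Rabs; lra. }
apply (Rmult_le_compat_l (h ^ 2)) in H; lra.
Qed.

(** * Limits of grid functions *)

Lemma is_derive_quadratic (Q : R -> R) t d C :
  (forall s, Rabs (Q s - Q t - (s - t) * d) <= C * (s - t) ^ 2) -> is_derive Q t d.
Proof.
intros H. apply is_derive_Reals. intros e He.
assert (C0 : 0 <= C).
{ specialize (H (t + 1)). pose proof (Rabs_pos (Q (t + 1) - Q t - (t + 1 - t) * d)).
  replace ((t + 1 - t) ^ 2) with 1 in H by ring. lra. }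
(* The added 1 covers the case [C = 0]. *)
assert (de : 0 < e / (C + 1)) by (apply Rdiv_lt_0_compat; lra).
exists (mkposreal _ de). simpl. intros x x0 Hx. specialize (H (t + x)).
replace (t + x - t) with x in H by ring.
replace ((Q (t + x) - Q t) / x - d) with ((Q (t + x) - Q t - x * d) / x) by now field.
unfold Rdiv. rewrite Rabs_mult, Rabs_inv.
assert (ax : 0 < Rabs x) by now apply Rabs_pos_lt.
apply Rle_lt_trans with (C * Rabs x).
- apply Rmult_le_reg_r with (Rabs x); [exact ax|].
  rewrite Rmult_assoc, Rinv_l, Rmult_1_r by lra.
  replace (C * Rabs x * Rabs x) with (C * x ^ 2); [exact H|].
  rewrite <- (pow2_abs x). ring.
- apply Rmult_lt_compat_r with (r := C + 1) in Hx; [|lra].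
  replace (e / (C + 1) * (C + 1)) with e in Hx by (field; lra). nra.
Qed.

Definition cell (h t : R) : Z := Int_part (t / h).

Lemma cell_spec h t : 0 < h -> IZR (cell h t) * h <= t < IZR (cell h t) * h + h.
Proof.
intros h0. unfold cell. destruct (base_Int_part (t / h)) as [H1 H2].
replace t with (t / h * h) at 2 3 by (field; lra). nra.
Qed.

Lemma cell_le h s t : 0 < h -> s <= t -> (cell h s <= cell h t)%Z.
Proof.
intros h0 Hst. pose proof (cell_spec h s h0). pose proof (cell_spec h t h0).
apply Z.lt_succ_r, lt_IZR. rewrite succ_IZR.
apply Rmult_lt_reg_r with h; lra.
Qed.

Lemma cell_add h t N : 0 < h -> cell h (t + INR N * h) = (cell h t + Z.of_nat N)%Z.
Proof.
intros h0. unfold cell. symmetry. apply Int_part_spec.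
rewrite plus_IZR, <- INR_IZR_INZ.
replace ((t + INR N * h) / h) with (t / h + INR N) by (field; lra).
destruct (base_Int_part (t / h)). lra.
Qed.

Section GridLimit.
Context (F : (nat -> Prop) -> Prop) {HF : compact_filter F}.
Context (h : nat -> R) (h0 : forall n, 0 < h n) (hlim : filterlim h F (locally 0)).

(** The constant is independent of the step. The bound on the values provides limits and closure
    under products; the bound on increments makes a shift by one site vanish in the limit. *)
Definition uniformly_lipschitz (u : nat -> Z -> R) : Prop :=
  exists C, forall n k,
    Rabs (u n k) <= C /\ Rabs (u n (k + 1)%Z - u n k) <= C * h n.

Definition grid_lim (u : nat -> Z -> R) (U : R -> R) : Prop :=
  forall t, filterlim (fun n => u n (cell (h n) t)) F (locally (U t)).

Lemma uniformly_lipschitz_const c : uniformly_lipschitz (fun _ _ => c).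
Proof.
exists (Rabs c). intros n k. split; [lra|].
rewrite Rminus_diag, Rabs_R0. pose proof (Rabs_pos c). pose proof (h0 n). nra.
Qed.

Lemma uniformly_lipschitz_plus u v : uniformly_lipschitz u -> uniformly_lipschitz v ->
  uniformly_lipschitz (fun n k => u n k + v n k).
Proof.
intros [C HC] [D HD]. exists (C + D). intros n k.
destruct (HC n k), (HD n k). split.
- eapply Rle_trans; [apply Rabs_triang|]. lra.
- replace (u n (k + 1)%Z + v n (k + 1)%Z - (u n k + v n k))
    with (u n (k + 1)%Z - u n k + (v n (k + 1)%Z - v n k)) by ring.
  eapply Rle_trans; [apply Rabs_triang|]. lra.
Qed.

Lemma uniformly_lipschitz_mult u v : uniformly_lipschitz u -> uniformly_lipschitz v ->
  uniformly_lipschitz (fun n k => u n k * v n k).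
Proof.
intros [C HC] [D HD]. exists (2 * (C * D) + C * D). intros n k.
destruct (HC n k) as [H1 H2], (HD n k) as [H3 H4].
destruct (HC n (k + 1)%Z) as [H5 _].
pose proof (Rabs_pos (u n k)). pose proof (Rabs_pos (v n k)). pose proof (h0 n).
assert (0 <= C * D) by (apply Rmult_le_pos; lra).
split.
- rewrite Rabs_mult.
  apply Rle_trans with (C * D); [apply Rmult_le_compat; lra|lra].
- replace (u n (k + 1)%Z * v n (k + 1)%Z - u n k * v n k)
    with (u n (k + 1)%Z * (v n (k + 1)%Z - v n k) + (u n (k + 1)%Z - u n k) * v n k) by ring.
  eapply Rle_trans; [apply Rabs_triang|]. rewrite !Rabs_mult.
  apply Rle_trans with (C * (D * h n) + C * h n * D); [|nra].
  apply Rplus_le_compat; apply Rmult_le_compat; auto using Rabs_pos.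
Qed.

Lemma uniformly_lipschitz_minus u v : uniformly_lipschitz u -> uniformly_lipschitz v ->
  uniformly_lipschitz (fun n k => u n k - v n k).
Proof.
intros Hu Hv.
destruct (uniformly_lipschitz_plus _ _ Hu
  (uniformly_lipschitz_mult _ _ (uniformly_lipschitz_const (-1)) Hv)) as [C HC].
exists C. intros n k. destruct (HC n k) as [H1 H2]. split.
- replace (u n k - v n k) with (u n k + -1 * v n k) by ring. exact H1.
- replace (u n (k + 1)%Z - v n (k + 1)%Z - (u n k - v n k))
    with (u n (k + 1)%Z + -1 * v n (k + 1)%Z - (u n k + -1 * v n k)) by ring. exact H2.
Qed.

Lemma uniformly_lipschitz_pred u : uniformly_lipschitz u ->
  uniformly_lipschitz (fun n k => u n (k - 1)%Z).
Proof.
intros [C HC]. exists C. intros n k. destruct (HC n (k - 1)%Z) as [H1 H2].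
split; [exact H1|]. replace (k + 1 - 1)%Z with (k - 1 + 1)%Z by ring. exact H2.
Qed.

Lemma uniformly_lipschitz_succ u : uniformly_lipschitz u ->
  uniformly_lipschitz (fun n k => u n (k + 1)%Z).
Proof. intros [C HC]. exists C. intros n k. now destruct (HC n (k + 1)%Z). Qed.

Lemma uniformly_lipschitz_dot (a b : nat -> Z -> axis -> R) :
  (forall i, uniformly_lipschitz (fun n k => a n k i)) ->
  (forall i, uniformly_lipschitz (fun n k => b n k i)) ->
  uniformly_lipschitz (fun n k => dot (a n k) (b n k)).
Proof.
intros Ha Hb. unfold dot.
repeat apply uniformly_lipschitz_plus; now apply uniformly_lipschitz_mult.
Qed.

Lemma uniformly_lipschitz_step u : uniformly_lipschitz u ->
  exists C, 0 <= C /\ forall n k m,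
    Rabs (u n (k + Z.of_nat m)%Z - u n k) <= C * (INR m * h n).
Proof.
intros [C HC]. exists C. split.
{ destruct (HC 0%nat 0%Z). pose proof (Rabs_pos (u 0%nat 0%Z)). lra. }
intros n k m. rewrite <- (zsum_telescope (u n)).
eapply Rle_trans; [apply zsum_abs|].
replace (C * (INR m * h n)) with (INR m * (C * h n)) by ring.
rewrite <- (zsum_const _ k). apply zsum_le. apply HC.
Qed.

(** One ultrafilter, fixed in advance, gives a limit at every real time; choice collects these
    limits into a function. *)
Lemma grid_lim_exists u : uniformly_lipschitz u -> exists U, grid_lim u U.
Proof.
intros [C HC].
destruct (functional_choice (fun t x =>
  filterlim (fun n => u n (cell (h n) t)) F (locally x))) as [U HU].
- intros t. apply (compact_filter_lim _ C). intros n. apply HC.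
- now exists U.
Qed.

Lemma grid_lim_close u v U C : (forall n k, Rabs (u n k - v n k) <= C * h n) ->
  grid_lim v U -> grid_lim u U.
Proof.
intros H Hv t. apply (lim_close F) with (3 := Hv t) (e := fun n => C * h n); [auto|].
replace 0 with (C * 0) by ring. now apply (lim_scal F).
Qed.

Lemma grid_lim_succ u U : uniformly_lipschitz u -> grid_lim u U ->
  grid_lim (fun n k => u n (k + 1)%Z) U.
Proof.
intros [C HC]. apply grid_lim_close with C. intros n k. apply HC.
Qed.

Lemma grid_lim_pred u U : uniformly_lipschitz u -> grid_lim u U ->
  grid_lim (fun n k => u n (k - 1)%Z) U.
Proof.
intros [C HC]. apply grid_lim_close with C. intros n k.
destruct (HC n (k - 1)%Z) as [_ H].
replace (k - 1 + 1)%Z with k in H by ring. now rewrite Rabs_minus_sym.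
Qed.

Lemma grid_lim_dot (a b : nat -> Z -> axis -> R) (A B : R -> axis -> R) :
  (forall i, grid_lim (fun n k => a n k i) (fun t => A t i)) ->
  (forall i, grid_lim (fun n k => b n k i) (fun t => B t i)) ->
  grid_lim (fun n k => dot (a n k) (b n k)) (fun t => dot (A t) (B t)).
Proof.
intros Ha Hb t. unfold dot.
repeat apply (lim_plus F); apply (lim_mult F);
  first [exact (Ha _ t) | exact (Hb _ t)].
Qed.

Lemma grid_lim_sample (G : R -> R) L :
  (forall s t, Rabs (G s - G t) <= L * Rabs (s - t)) ->
  grid_lim (fun n k => G (IZR k * h n)) G.
Proof.
intros HL t.
assert (L0 : 0 <= L).
{ specialize (HL 1 0). pose proof (Rabs_pos (G 1 - G 0)).
  rewrite Rminus_0_r, Rabs_R1 in HL. lra. }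
apply (lim_close F) with (fun _ => G t) (fun n => L * h n).
- intros n. eapply Rle_trans; [apply HL|]. apply Rmult_le_compat_l; [exact L0|].
  pose proof (cell_spec (h n) t (h0 n)). split_Rabs; lra.
- replace 0 with (L * 0) by ring. now apply (lim_scal F).
- apply (lim_const F).
Qed.

(** Each of the two roundings loses less than one step, so the elapsed grid time differs from
    [t - s] by at most [h n]. *)
Lemma cell_count_lim s t : s <= t ->
  filterlim (fun n => INR (Z.to_nat (cell (h n) t - cell (h n) s)) * h n)
    F (locally (t - s)).
Proof.
intros Hst. apply (lim_close F) with (fun _ => t - s) h; [|exact hlim|apply (lim_const F)].
intros n. pose proof (cell_le _ _ _ (h0 n) Hst).
rewrite INR_IZR_INZ, Z2Nat.id, minus_IZR by lia.
pose proof (cell_spec (h n) s (h0 n)). pose proof (cell_spec (h n) t (h0 n)).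
apply Rabs_le. lra.
Qed.

Lemma cell_count n s t : s <= t ->
  (cell (h n) t =
   cell (h n) s + Z.of_nat (Z.to_nat (cell (h n) t - cell (h n) s)))%Z.
Proof. intros Hst. pose proof (cell_le _ _ _ (h0 n) Hst). rewrite Z2Nat.id; lia. Qed.

Lemma grid_lim_lipschitz u U : uniformly_lipschitz u -> grid_lim u U ->
  exists C, 0 <= C /\ forall s t, Rabs (U s - U t) <= C * Rabs (s - t).
Proof.
intros Hu HU. destruct (uniformly_lipschitz_step _ Hu) as [C [C0 HC]].
exists C. split; [exact C0|].
assert (main : forall s t, s <= t -> Rabs (U t - U s) <= C * (t - s)).
{ intros s t Hst.
  apply (lim_abs_le F (fun n => u n (cell (h n) t) - u n (cell (h n) s))
    (fun n => C * (INR (Z.to_nat (cell (h n) t - cell (h n) s)) * h n))).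
  - intros n. rewrite (cell_count n s t Hst) at 1. apply HC.
  - now apply (lim_minus F).
  - now apply (lim_scal F), cell_count_lim. }
intros s t. destruct (Rle_dec s t) as [Hst|Hst].
- rewrite Rabs_minus_sym, (Rabs_minus_sym s), (Rabs_pos_eq (t - s)) by lra. auto.
- rewrite (Rabs_pos_eq (s - t)) by lra. apply main. lra.
Qed.

(** A discrete Taylor estimate with quadratic remainder, uniform in the step, survives the limit and
    yields differentiability. *)
Lemma grid_lim_derive q w Q W : uniformly_lipschitz w ->
  (forall n k, q n (k + 1)%Z - q n k = h n * w n k) ->
  grid_lim q Q -> grid_lim w W -> forall t, is_derive Q t (W t).
Proof.
intros Hw Hqw HQ HW.
destruct (uniformly_lipschitz_step _ Hw) as [C [C0 HC]].
destruct (grid_lim_lipschitz _ _ Hw HW) as [D [D0 HD]].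
(* Step [m] adds [h (w (k + m) - w k)], at most [C m h^2], and [m^2 + m <= (m + 1)^2] closes the
   induction. *)
assert (taylor : forall n k m,
  Rabs (q n (k + Z.of_nat m)%Z - q n k - INR m * h n * w n k) <=
  C * ((INR m * h n) * (INR m * h n))).
{ intros n k m. pose proof (h0 n) as hn. induction m as [|m IH].
  - rewrite Z.add_0_r. simpl.
    replace (q n k - q n k - 0 * h n * w n k) with 0 by ring. rewrite Rabs_R0. lra.
  - replace (k + Z.of_nat (S m))%Z with (k + Z.of_nat m + 1)%Z by lia.
    rewrite S_INR.
    replace (q n (k + Z.of_nat m + 1)%Z) with
      (q n (k + Z.of_nat m)%Z + h n * w n (k + Z.of_nat m)%Z) by (rewrite <- Hqw; ring).
    replace (_ - _) with ((q n (k + Z.of_nat m)%Z - q n k - INR m * h n * w n k)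
      + h n * (w n (k + Z.of_nat m)%Z - w n k)) by ring.
    eapply Rle_trans; [apply Rabs_triang|].
    rewrite Rabs_mult, (Rabs_pos_eq (h n)) by lra.
    pose proof (Rmult_le_compat_l (h n) _ _ (Rlt_le _ _ hn) (HC n k m)).
    pose proof (pos_INR m).
    assert (0 <= C * (h n * h n) * (INR m + 1)).
    { apply Rmult_le_pos; [|lra]. apply Rmult_le_pos; [exact C0|nra]. }
    lra. }
assert (main : forall s t, s <= t ->
  Rabs (Q t - Q s - (t - s) * W s) <= C * ((t - s) * (t - s))).
{ intros s t Hst. pose proof (cell_count_lim s t Hst) as Hc.
  set (m n := Z.to_nat (cell (h n) t - cell (h n) s)) in *.
  apply (lim_abs_le F (fun n => q n (cell (h n) t) - q n (cell (h n) s)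
    - INR (m n) * h n * w n (cell (h n) s))
    (fun n => C * ((INR (m n) * h n) * (INR (m n) * h n)))).
  - intros n. rewrite (cell_count n s t Hst) at 1. apply taylor.
  - apply (lim_minus F); [now apply (lim_minus F)|]. now apply (lim_mult F).
  - apply (lim_scal F). now apply (lim_mult F). }
intros t. apply is_derive_quadratic with (C + D). intros s.
destruct (Rle_dec t s) as [Hts|Hts].
- eapply Rle_trans; [apply main, Hts|].
  assert (0 <= D * (s - t) ^ 2) by (apply Rmult_le_pos; [exact D0 | apply pow2_ge_0]). lra.
(* For [s < t] the estimate expands around [s]; replacing [W s] by [W t] costs at most
   [D (t - s)^2]. *)
- pose proof (main s t ltac:(lra)) as H1. pose proof (HD t s) as H2.
  rewrite (Rabs_pos_eq (t - s)) in H2 by lra.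
  replace (Q s - Q t - (s - t) * W t) with
    (- (Q t - Q s - (t - s) * W s) + (t - s) * (W t - W s)) by ring.
  eapply Rle_trans; [apply Rabs_triang|].
  rewrite Rabs_Ropp, Rabs_mult, (Rabs_pos_eq (t - s)) by lra.
  apply (Rmult_le_compat_l (t - s)) in H2; lra.
Qed.

End GridLimit.

(** * The periodic solution *)

Lemma uniformly_lipschitz_accel h (h0 : forall n, 0 < h n) l (G p v u : nat -> Z -> axis -> R) :
  (forall i, uniformly_lipschitz h (fun n k => G n k i)) ->
  (forall i, uniformly_lipschitz h (fun n k => p n k i)) ->
  (forall i, uniformly_lipschitz h (fun n k => v n k i)) ->
  (forall i, uniformly_lipschitz h (fun n k => u n k i)) ->
  forall i, uniformly_lipschitz h (fun n k => accel l (G n k) (p n k) (v n k) (u n k) i).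
Proof.
intros HG Hp Hv Hu i. unfold accel, Rdiv.
repeat first [apply uniformly_lipschitz_minus | apply uniformly_lipschitz_plus
  | apply uniformly_lipschitz_mult | apply uniformly_lipschitz_dot
  | apply uniformly_lipschitz_const]; auto.
Qed.

Lemma grid_lim_accel F {HF : compact_filter F} h l (G p v u : nat -> Z -> axis -> R)
    (G' P V U : R -> axis -> R) :
  (forall i, grid_lim F h (fun n k => G n k i) (fun t => G' t i)) ->
  (forall i, grid_lim F h (fun n k => p n k i) (fun t => P t i)) ->
  (forall i, grid_lim F h (fun n k => v n k i) (fun t => V t i)) ->
  (forall i, grid_lim F h (fun n k => u n k i) (fun t => U t i)) ->
  forall i, grid_lim F h (fun n k => accel l (G n k) (p n k) (v n k) (u n k) i)
    (fun t => accel l (G' t) (P t) (V t) (U t) i).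
Proof.
intros HG Hp Hv Hu i t. unfold accel, Rdiv.
apply (lim_minus F); [|apply HG].
apply (lim_mult F); [|apply Hp].
apply (lim_mult F); [|apply (lim_const F)].
apply (lim_minus F); [now apply grid_lim_dot|].
apply (lim_mult F); [|apply (lim_const F)].
apply (lim_plus F); now apply grid_lim_dot.
Qed.

Lemma grid_lim_family F {HF : compact_filter F} h (u : nat -> Z -> axis -> R) :
  (forall i, uniformly_lipschitz h (fun n k => u n k i)) ->
  exists U : R -> axis -> R, forall i, grid_lim F h (fun n k => u n k i) (fun t => U t i).
Proof.
intros Hu.
destruct (functional_choice (fun i U => grid_lim F h (fun n k => u n k i) U)) as [U HU].
- intros i. now apply grid_lim_exists.
- now exists (fun t i => U i t).
Qed.

Lemma periodic_orbit l T B L (G : R -> axis -> R) : 0 < l -> 0 < T ->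
  (forall t i, Rabs (G t i) <= B) ->
  (forall i s t, Rabs (G s i - G t i) <= L * Rabs (s - t)) ->
  (forall t i, G (t + T) i = G t i) -> (forall t, 0 < G t Up) ->
  exists P V : R -> axis -> R,
    (forall t i, is_derive (fun s => P s i) t (V t i)) /\
    (forall t i, is_derive (fun s => V s i) t (accel l (G t) (P t) (V t) (V t) i)) /\
    (forall t i, P (t + T) i = P t i) /\
    (forall t, dot (P t) (P t) = l ^ 2) /\ (forall t, 0 <= P t Up).
Proof.
intros l0 T0 GB GL Gper Gup.
destruct compact_filter_exists as [F HF].
(* The shift by two ensures [2 <= N n], and [N n] steps make up exactly one period [T]. *)
set (N n := S (S n)). set (h n := T / INR (N n)).
assert (N0 : forall n, 0 < INR (N n)) by (intros n; apply lt_0_INR; unfold N; lia).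
assert (h0 : forall n, 0 < h n) by (intros n; now apply Rdiv_lt_0_compat).
assert (hN : forall n, INR (N n) * h n = T)
  by (intros n; unfold h; field; specialize (N0 n); lra).
assert (hlim : filterlim h F (locally 0)).
{ unfold h, Rdiv. replace 0 with (T * 0) by ring. apply (lim_scal F).
  apply filterlim_filter_le_1 with (1 := compact_filter_eventually).
  apply (lim_inv_INR_shift 2). }
set (g n k := G (IZR k * h n)).
assert (Hex : forall n, exists p, hemi_loop l (N n) p /\
    (forall k i, Rabs (velocity (h n) p k i) <= 16 * T * B) /\
    (forall k i, velocity (h n) p k i - velocity (h n) p (k - 1) i =
       h n * accel l (g n k) (p k) (velocity (h n) p k) (velocity (h n) p (k - 1)) i)).
{ intros n. rewrite <- (hN n). apply discrete_orbit; auto.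
  - unfold N; lia.
  - intros k i. apply GB.
  - intros k i. unfold g. rewrite plus_IZR, <- INR_IZR_INZ, Rmult_plus_distr_r, hN.
    apply Gper.
  - intros k. apply Gup. }
apply functional_choice in Hex. destruct Hex as [p Hex].
assert (Hp : forall n, hemi_loop l (N n) (p n)) by apply Hex.
set (v n := velocity (h n) (p n)).
assert (Hv : forall n k i, Rabs (v n k i) <= 16 * T * B) by (intros n; apply (Hex n)).
set (a n k := accel l (g n k) (p n k) (v n k) (v n (k - 1)%Z)).
assert (Ha : forall n k i, v n k i - v n (k - 1)%Z i = h n * a n k i)
  by (intros n; apply (Hex n)).
assert (Hpv : forall n k i, p n (k + 1)%Z i - p n k i = h n * v n k i).
{ intros n k i. unfold v, velocity. field. specialize (h0 n). lra. }
assert (pl : forall n k i, Rabs (p n k i) <= l).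
{ intros n k i. apply sphere_coord_le; [lra | apply (hemi_sphere _ _ _ (Hp n))]. }
assert (B0 : 0 <= B) by (eapply Rle_trans; [apply Rabs_pos | apply (GB 0 Up)]).
assert (C0 : 0 <= 16 * T * B) by (apply Rmult_le_pos; lra).
assert (ulg : forall i, uniformly_lipschitz h (fun n k => g n k i)).
{ intros i. exists (B + Rabs L). intros n k. pose proof (Rabs_pos L). split.
  - unfold g. specialize (GB (IZR k * h n) i). lra.
  - unfold g. eapply Rle_trans; [apply GL|].
    rewrite plus_IZR. replace ((IZR k + 1) * h n - IZR k * h n) with (h n) by ring.
    specialize (h0 n). rewrite (Rabs_pos_eq (h n)) by lra.
    apply Rmult_le_compat_r; [lra|]. pose proof (Rle_abs L). lra. }
assert (ulp : forall i, uniformly_lipschitz h (fun n k => p n k i)).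
{ intros i. exists (l + 16 * T * B). intros n k. specialize (h0 n). split.
  - specialize (pl n k i). lra.
  - rewrite Hpv, Rabs_mult, (Rabs_pos_eq (h n)), Rmult_comm by lra.
    apply Rmult_le_compat_r; [lra|]. specialize (Hv n k i). lra. }
(* The increments of [v] are [h a], and [a] is bounded because [p] and [v] are. *)
assert (ulv : forall i, uniformly_lipschitz h (fun n k => v n k i)).
{ intros i.
  set (D := (3 * (B * l) + 3 * (16 * T * B * (16 * T * B))) / l ^ 2 * l + B).
  exists (16 * T * B + D).
  assert (D0 : forall n k, Rabs (a n k i) <= D).
  { intros n k. unfold a, accel, D.
    pose proof (dot_abs_le (g n k) (p n k) B l (fun j => GB _ j) (pl n k)).
    pose proof (dot_abs_le (v n k) (v n k) _ _ (Hv n k) (Hv n k)).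
    pose proof (dot_abs_le _ _ _ _ (Hv n (k - 1)%Z) (Hv n (k - 1)%Z)).
    eapply Rle_trans; [apply Rabs_triang|]. rewrite Rabs_Ropp.
    apply Rplus_le_compat; [|apply GB].
    rewrite Rabs_mult. apply Rmult_le_compat; try apply Rabs_pos; [|apply pl].
    assert (l2 : 0 < / l ^ 2) by (apply Rinv_0_lt_compat, pow_lt; lra).
    unfold Rdiv at 1. rewrite Rabs_mult, (Rabs_pos_eq (/ l ^ 2)) by lra.
    apply Rmult_le_compat_r; [lra|]. split_Rabs; lra. }
  intros n k. specialize (h0 n). split.
  - specialize (Hv n k i). pose proof (D0 n k). pose proof (Rabs_pos (a n k i)). lra.
  - pose proof (Ha n (k + 1)%Z i) as E. replace (k + 1 - 1)%Z with k in E by ring.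
    rewrite E, Rabs_mult, (Rabs_pos_eq (h n)), Rmult_comm by lra.
    apply Rmult_le_compat_r; [lra|]. specialize (D0 n (k + 1)%Z). lra. }
assert (ula : forall i, uniformly_lipschitz h (fun n k => a n k i)).
{ apply uniformly_lipschitz_accel; auto.
  intros i. apply (uniformly_lipschitz_pred _ (fun n k => v n k i)), ulv. }
destruct (grid_lim_family F h p ulp) as [P HP].
destruct (grid_lim_family F h v ulv) as [V HV].
(* The velocities at [k] and [k - 1] have the same limit, so the averaged kinetic term becomes
   [dot (V t) (V t)]. *)
assert (HA : forall i, grid_lim F h (fun n k => a n k i)
  (fun t => accel l (G t) (P t) (V t) (V t) i)).
{ apply grid_lim_accel; auto.
  - intros i. apply (grid_lim_sample F h h0 hlim (fun t => G t i) L), GL.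
  - intros i. apply (grid_lim_pred F h hlim (fun n k => v n k i)); auto. }
assert (HPdot : grid_lim F h (fun n k => dot (p n k) (p n k)) (fun t => dot (P t) (P t)))
  by now apply grid_lim_dot.
exists P, V. split; [|split; [|split; [|split]]].
- intros t i.
  apply (grid_lim_derive F h h0 hlim (fun n k => p n k i) (fun n k => v n k i)
    (fun t => P t i) (fun t => V t i)); auto.
(* The forward increment of [v] at [k] is [h] times the acceleration at [k + 1], whose limit is that
   of the acceleration at [k]. *)
- intros t i.
  apply (grid_lim_derive F h h0 hlim (fun n k => v n k i) (fun n k => a n (k + 1)%Z i)
    (fun t => V t i) (fun t => accel l (G t) (P t) (V t) (V t) i)); auto.
  + apply (uniformly_lipschitz_succ _ (fun n k => a n k i)), ula.
  + intros n k. rewrite <- Ha. now replace (k + 1 - 1)%Z with k by ring.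
  + apply (grid_lim_succ F h hlim (fun n k => a n k i)); auto.
- intros t i. apply (lim_unique F (fun n => p n (cell (h n) (t + T)) i)); [apply HP|].
  apply (lim_ext F) with (fun n => p n (cell (h n) t) i); [|apply HP].
  intros n. rewrite <- (hN n), cell_add by auto.
  symmetry. apply (hemi_periodic _ _ _ (Hp n)).
- intros t. apply (lim_unique F _ _ _ (HPdot t)).
  apply (lim_ext F) with (fun _ => l ^ 2); [|apply (lim_const F)].
  intros n. symmetry. apply (hemi_sphere _ _ _ (Hp n)).
- intros t. apply (lim_le F (fun _ => 0) (fun n => p n (cell (h n) t) Up));
    [|apply (lim_const F)|apply HP].
  intros n. apply (hemi_up _ _ _ (Hp n)).
Qed.

(** * Bounds on the forcing, avoidance of the equator, and return to the plane *)

Lemma continuous_periodic_bounded (f : R -> R) T : 0 < T -> periodic T f ->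
  (forall t, continuous f t) -> exists M, forall t, Rabs (f t) <= M.
Proof.
intros T0 Hper Hc.
destruct (continuity_ab_maj (fun t => Rabs (f t)) 0 T) as [m [Hm _]]; [lra| |].
{ intros t _. apply continuity_pt_filterlim.
  apply (continuous_comp f Rabs); [apply Hc | apply continuous_Rabs]. }
exists (Rabs (f m)). intros t.
assert (shift : forall k s, f (s + INR k * T) = f s).
{ intros k s. induction k as [|k IH]; [simpl; f_equal; ring|].
  rewrite S_INR. replace (s + (INR k + 1) * T) with (s + INR k * T + T) by ring.
  now rewrite Hper. }
assert (Hs : f (t - IZR (cell T t) * T) = f t).
{ destruct (Z.le_gt_cases 0 (cell T t)) as [H|H].
  - rewrite <- (shift (Z.to_nat (cell T t)) (t - _)). f_equal.
    rewrite INR_IZR_INZ, Z2Nat.id by lia. ring.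
  - rewrite <- (shift (Z.to_nat (- cell T t)) t). f_equal.
    rewrite INR_IZR_INZ, Z2Nat.id, opp_IZR by lia. ring. }
rewrite <- Hs. apply Hm. pose proof (cell_spec T t T0). lra.
Qed.

Lemma derive_bound_lipschitz (f : R -> R) M : (forall t, ex_derive f t) ->
  (forall t, Rabs (Derive f t) <= M) -> forall s t, Rabs (f s - f t) <= M * Rabs (s - t).
Proof.
intros Hd HM s t.
destruct (MVT_gen f t s (Derive f)) as [c [_ ->]].
- intros x _. now apply Derive_correct.
- intros x _. apply continuity_pt_filterlim. now apply (ex_derive_continuous f).
- rewrite Rabs_mult. apply Rmult_le_compat_r; [apply Rabs_pos | apply HM].
Qed.

Lemma Derive_n_periodic T f n : periodic T f -> periodic T (Derive_n f n).
Proof.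
intros H t. rewrite <- Derive_n_comp_trans. now apply Derive_n_ext.
Qed.

(** Periodicity bounds the continuous second and third derivatives, and the bound on the third is a
    Lipschitz constant for the second, as [periodic_orbit] requires of its forcing. *)
Lemma Cn3_second_derivative T f : 0 < T -> Cn 3 f -> periodic T f ->
  exists M, (forall t, Rabs (Derive_n f 2 t) <= M) /\
    (forall s t, Rabs (Derive_n f 2 s - Derive_n f 2 t) <= M * Rabs (s - t)).
Proof.
intros T0 [Hd Hc] Hper.
destruct (continuous_periodic_bounded (Derive_n f 2) T) as [M HM]; auto.
{ now apply Derive_n_periodic. }
{ intros t. apply (ex_derive_continuous (Derive_n f 2)), Hd. lia. }
destruct (continuous_periodic_bounded (Derive_n f 3) T) as [K HK]; auto.
{ now apply Derive_n_periodic. }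
exists (M + K).
assert (0 <= M) by (eapply Rle_trans; [apply Rabs_pos | apply (HM 0)]).
assert (0 <= K) by (eapply Rle_trans; [apply Rabs_pos | apply (HK 0)]).
split.
- intros t. specialize (HM t). lra.
- intros s t. eapply Rle_trans.
  + apply (derive_bound_lipschitz _ K); [intros x; apply Hd; lia | exact HK].
  + apply Rmult_le_compat_r; [apply Rabs_pos | lra].
Qed.

(** At the minimum [v t = 0]. If [a < 0], then [v] is negative just after [t], and the mean value
    theorem makes [z] negative there. *)
Lemma zero_min_second_derivative (z v : R -> R) t a :
  (forall s, 0 <= z s) -> z t = 0 -> (forall s, is_derive z s (v s)) ->
  is_derive v t a -> 0 <= a.
Proof.
intros Hz zt Hd Hv. apply Rnot_lt_le; intros neg.
assert (vt : v t = 0).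
{ pose proof (proj1 (is_derive_Reals _ _ _) (Hd t)) as D.
  set (pr := exist _ (v t) D : derivable_pt z t).
  change (derive_pt z t pr = 0).
  apply (deriv_minimum z (t - 1) (t + 1)); try lra. intros x _ _. rewrite zt. apply Hz. }
destruct (proj1 (is_derive_Reals _ _ _) Hv (- a / 2)) as [d Hd']; [lra|].
assert (vneg : forall x, 0 < x < d -> v (t + x) < 0).
{ intros x Hx. specialize (Hd' x ltac:(lra)).
  rewrite Rabs_pos_eq in Hd' by lra. specialize (Hd' ltac:(lra)).
  rewrite vt, Rminus_0_r in Hd'. apply Rabs_lt_between in Hd'.
  apply Rmult_lt_reg_r with (/ x); [apply Rinv_0_lt_compat; lra|].
  unfold Rdiv in Hd'. lra. }
pose proof (cond_pos d) as d0.
destruct (MVT_cor2 z v t (t + d / 2)) as [c [Hc1 Hc2]]; [lra| |].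
- intros x _. now apply is_derive_Reals.
- specialize (Hz (t + d / 2)). specialize (vneg (c - t) ltac:(lra)).
  replace (t + (c - t)) with c in vneg by ring. nra.
Qed.

Theorem theorem1p2 (l g T : R) (f1 f2 : R -> R) :
  0 < l -> 0 < g -> 0 < T ->
  Cn 3 f1 -> Cn 3 f2 -> periodic T f1 -> periodic T f2 ->
  exists x1 x2 : R -> R,
    Cn 2 x1 /\ Cn 2 x2 /\ periodic T x1 /\ periodic T x2 /\
    (forall t : R, x1 t ^ 2 + x2 t ^ 2 < l ^ 2) /\
    (forall t : R, whitney_eq l g f1 f2 x1 x2 t).
Proof.
intros l0 g0 T0 Hf1 Hf2 Hper1 Hper2.
destruct (Cn3_second_derivative T f1) as [M1 [HM1 HL1]]; auto.
destruct (Cn3_second_derivative T f2) as [M2 [HM2 HL2]]; auto.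
set (G t i := match i with East => Derive_n f1 2 t | North => Derive_n f2 2 t | Up => g end).
assert (M10 : 0 <= M1) by (eapply Rle_trans; [apply Rabs_pos | apply (HM1 0)]).
assert (M20 : 0 <= M2) by (eapply Rle_trans; [apply Rabs_pos | apply (HM2 0)]).
assert (GL : forall i s t, Rabs (G s i - G t i) <= (M1 + M2) * Rabs (s - t)).
{ intros i s t. pose proof (Rabs_pos (s - t)) as st. destruct i; unfold G.
  - specialize (HL1 s t). pose proof (Rmult_le_pos _ _ M20 st). lra.
  - specialize (HL2 s t). pose proof (Rmult_le_pos _ _ M10 st). lra.
  - rewrite Rminus_diag, Rabs_R0. apply Rmult_le_pos; lra. }
destruct (periodic_orbit l T (M1 + M2 + g) (M1 + M2) G)
  as [P [V [HP [HV [Pper [sph up]]]]]]; auto.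
{ intros t [| |]; unfold G.
  - specialize (HM1 t). lra.
  - specialize (HM2 t). lra.
  - rewrite Rabs_pos_eq; lra. }
{ intros t [| |]; unfold G; [| |reflexivity]; now apply Derive_n_periodic. }
(* At height zero the multiple of [P t] in [accel] has no vertical component, so the vertical
   acceleration would be [- g]. *)
assert (up' : forall t, 0 < P t Up).
{ intros t. destruct (Rle_lt_or_eq_dec _ _ (up t)) as [pos|zero]; [exact pos|].
  exfalso.
  pose proof (zero_min_second_derivative (fun s => P s Up) (fun s => V s Up) t _
    up (eq_sym zero) (fun s => HP s Up) (HV t Up)) as H.
  unfold accel in H. rewrite <- zero in H. change (G t Up) with g in H. lra. }
(* Differentiating the sphere constraint determines the vertical velocity from the horizontal
   motion. *)
assert (ortho : forall t, dot (P t) (V t) = 0).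
{ intros t.
  assert (D : is_derive (fun s => dot (P s) (P s)) t (2 * dot (P t) (V t))).
  { assert (sq : forall i, is_derive (fun s => P s i * P s i) t
      (V t i * P t i + P t i * V t i)).
    { intros i. exact (is_derive_mult _ _ t _ _ (HP t i) (HP t i) Rmult_comm). }
    replace (2 * dot (P t) (V t)) with
      (V t East * P t East + P t East * V t East
      + (V t North * P t North + P t North * V t North)
      + (V t Up * P t Up + P t Up * V t Up)) by (unfold dot; ring).
    exact (is_derive_plus _ _ t _ _
      (is_derive_plus _ _ t _ _ (sq East) (sq North)) (sq Up)). }
  apply (is_derive_ext _ (fun _ => l ^ 2)) in D; [|exact sph].
  apply is_derive_unique in D. rewrite Derive_const in D. lra. }
assert (D1 : forall i t, Derive (fun s => P s i) t = V t i)
  by (intros; apply is_derive_unique, HP).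
assert (D2 : forall i t, Derive_n (fun s => P s i) 2 t =
  accel l (G t) (P t) (V t) (V t) i).
{ intros i t. apply is_derive_unique. apply is_derive_ext with (fun s => V s i); [|apply HV].
  intros s. symmetry. apply D1. }
assert (cP : forall i t, continuous (fun s => P s i) t)
  by (intros; apply (ex_derive_continuous (fun s => P s i)); eexists; apply HP).
assert (cV : forall i t, continuous (fun s => V s i) t)
  by (intros; apply (ex_derive_continuous (fun s => V s i)); eexists; apply HV).
assert (cG : forall i t, continuous (fun s => G s i) t).
{ intros i t. destruct i; unfold G.
  - apply (ex_derive_continuous (Derive_n f1 2)), Hf1. lia.
  - apply (ex_derive_continuous (Derive_n f2 2)), Hf2. lia.
  - apply continuous_const. }
assert (cdot : forall a b : R -> axis -> R,
  (forall i t, continuous (fun s => a s i) t) -> (forall i t, continuous (fun s => b s i) t) ->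
  forall t, continuous (fun s => dot (a s) (b s)) t).
{ intros a b Ha Hb t. unfold dot.
  assert (term : forall i, continuous (fun s => a s i * b s i) t)
    by (intros i; exact (continuous_mult (K := R_AbsRing) _ _ t (Ha i t) (Hb i t))).
  exact (continuous_plus (V := R_NormedModule) _ _ t
    (continuous_plus (V := R_NormedModule) _ _ t (term East) (term North)) (term Up)). }
assert (C2 : forall i, Cn 2 (fun s => P s i)).
{ intros i. split.
  - intros k t Hk. destruct k as [|[|k]]; [| |lia].
    + eexists. apply HP.
    + exists (accel l (G t) (P t) (V t) (V t) i).
      apply is_derive_ext with (fun s => V s i); [|apply HV].
      intros s. symmetry. apply D1.
  - intros t. apply continuous_ext with (fun s => accel l (G s) (P s) (V s) (V s) i).
    { intros s. symmetry. apply D2. }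
    refine (continuous_minus (V := R_NormedModule) _ _ t _ (cG i t)).
    refine (continuous_mult (K := R_AbsRing) _ _ t _ (cP i t)).
    refine (continuous_mult (K := R_AbsRing) _ _ t _ (continuous_const _ t)).
    refine (continuous_minus (V := R_NormedModule) _ _ t (cdot _ _ cG cP t) _).
    refine (continuous_mult (K := R_AbsRing) _ _ t _ (continuous_const _ t)).
    exact (continuous_plus (V := R_NormedModule) _ _ t (cdot _ _ cV cV t) (cdot _ _ cV cV t)). }
exists (fun t => P t East), (fun t => P t North).
split; [apply C2|]. split; [apply C2|].
split; [intros t; apply Pper|]. split; [intros t; apply Pper|].
split.
- intros t. specialize (sph t). unfold dot in sph.
  pose proof (Rmult_lt_0_compat _ _ (up' t) (up' t)). lra.
(* With height [z], the sphere gives [sqrt (l^2 - |x|^2) = z] and orthogonality gives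
   [x . x' = - z z']. The fraction in the equation is therefore [z'^2], the vertical part of the
   squared speed. *)
- intros t. unfold whitney_eq. rewrite !D1, !D2.
  specialize (sph t). specialize (up' t). specialize (ortho t).
  unfold dot in sph, ortho.
  replace (l ^ 2 - (P t East ^ 2 + P t North ^ 2)) with (P t Up ^ 2) by lra.
  rewrite sqrt_pow2 by lra.
  replace (P t East * V t East + P t North * V t North) with (- (P t Up * V t Up)) by lra.
  unfold accel, dot, G. split; field; lra.
Qed.
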